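(* Let $G$ be a (discrete) group and let $H$ be a proper subgroup of $G$. Then the following conditions are equivalent: (1) $H$ is inner amenable relative to $G$. (2) There exists a net $(\xi_n)$ of unit vectors in $\ell^2(G)$ such that $\mathrm{supp}(\xi_n)\subset G\smallsetminus H$ for every $n$ and $$\lim_{n}\Vert\alpha(h)\xi_n-\xi_n\Vert_2=0$$ for every $h\in H$. (3) There exists a state $\varphi$ on $B(\ell^2(G))$ such that $\varphi(\alpha(h))=1$ for every $h\in H$ and $\varphi(e_H)=0$.
   Context: Groups are discrete. For a pair of groups $H\subset G$, $H$ is inner amenable relative to $G$ if $H$ is a proper subgroup of $G$ and there exists a state on $\ell^\infty(G\smallsetminus H)$ which is invariant under the action of $H$ on $G\smallsetminus H=\{g\in G: g\notin H\}$ by conjugation. $\alpha$ denotes the unitary representation of $G$ on $\ell^2(G)$ by conjugation: $(\alpha(g)\xi)(g')=\xi(g^{-1}g'g)$ for $g,g'\in G$, $\xi\in\ell^2(G)$. The operator $e_H\in B(\ell^2(G))$ is the orthogonal projection onto $\ell^2(H)$, i.e. multiplication by the characteristic function of $H$. For $\xi\in\ell^2(G)$, $\mathrm{supp}(\xi)=\{g\in G:\xi(g)\neq 0\}$. *)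

(* Defs.v *)
From HB Require Import structures.
From mathcomp Require Import all_boot all_order all_algebra.
From mathcomp Require Import all_classical all_reals all_analysis.
From mathcomp Require Import ring.
From mathcomp Require Import complex.
From mathcomp.analysis.showcase Require summability.

Set Implicit Arguments.
Unset Strict Implicit.
Unset Printing Implicit Defensive.

Import Order.TTheory GRing.Theory Num.Theory numFieldNormedType.Exports.

Local Open Scope classical_set_scope.
Local Open Scope complex_scope.
Local Open Scope ring_scope.

(* [complex.Re `|z|] is the modulus of [z] as an element of [R]; the norm of
   [R[i]] itself takes its values in [R[i]]. *)
Section Modulus.
Variable R : realType.
Implicit Types z w : R[i].

Lemma modulusE z : (complex.Re `|z|)%:C = `|z|.
Proof. by rewrite normc_def. Qed.

Lemma modulus_ge0 z : 0 <= complex.Re `|z|.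
Proof. by rewrite -lecR modulusE; exact: normr_ge0. Qed.

Lemma modulusM z w : complex.Re `|z * w| = complex.Re `|z| * complex.Re `|w|.
Proof.
by apply: (@complexI R); rewrite rmorphM /= !modulusE normrM.
Qed.

Lemma modulusD z w :
  complex.Re `|z + w| <= complex.Re `|z| + complex.Re `|w|.
Proof. by rewrite -lecR rmorphD /= !modulusE ler_normD. Qed.

Lemma modulusD2 z w : complex.Re `|z + w| ^+ 2 <=
  2 * complex.Re `|z| ^+ 2 + 2 * complex.Re `|w| ^+ 2.
Proof.
have h : complex.Re `|z + w| ^+ 2 <=
    (complex.Re `|z| + complex.Re `|w|) ^+ 2.
  by rewrite lerXn2r ?nnegrE ?addr_ge0 ?modulus_ge0 ?modulusD.
apply: le_trans h _; rewrite -subr_ge0.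
set a := complex.Re `|z|; set b := complex.Re `|w|.
rewrite (_ : _ - _ = (a - b) ^+ 2) ?sqr_ge0//.
by rewrite sqrrD sqrrB; ring.
Qed.

End Modulus.

(* Complex-valued square-summable families; sums over the arbitrary index set
   are suprema of finite sums. *)
Section L2.
Variables (R : realType) (I : choiceType).
Implicit Types (f g : I -> R[i]) (c : R[i]).

Definition sqsum f : \bar R := \esum_(i in setT) (complex.Re `|f i| ^+ 2)%:E.

Definition sqsummable : {pred I -> R[i]} :=
  [pred f : I -> R[i] | (sqsum f < +oo)%E].

Lemma sqsum_ge0 f : (0 <= sqsum f)%E.
Proof. by apply: esum_ge0 => i _; rewrite lee_fin sqr_ge0. Qed.

Lemma esumZ (r : R) (a : I -> \bar R) : 0 <= r -> (forall i, 0 <= a i)%E ->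
  \esum_(i in setT) (r%:E * a i)%E = (r%:E * \esum_(i in setT) a i)%E.
Proof.
move=> r0 a0; rewrite /esum -ereal_supZl//; last first.
  by apply/set0P; exists (\sum_(x \in set0) a x)%E; exists set0.
congr ereal_sup; apply/seteqP; split=> [_ [F Ff <-]|_ [_ [F Ff <-] <-]] /=.
  exists (\sum_(x \in F) a x)%E; first by exists F.
  by rewrite ge0_mule_fsumr.
by exists F => //; rewrite ge0_mule_fsumr.
Qed.

Lemma sqsumZ c f : sqsum (c *: f) = ((complex.Re `|c| ^+ 2)%:E * sqsum f)%E.
Proof.
rewrite /sqsum -esumZ ?sqr_ge0//; last by move=> i; rewrite lee_fin sqr_ge0.
apply: eq_esum => i _.
by rewrite -EFinM -exprMn -modulusM.
Qed.

Lemma sqsumD f g : (sqsum (f + g)%R <= 2%:E * sqsum f + 2%:E * sqsum g)%E.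
Proof.
rewrite /sqsum -!esumZ//; try by move=> i; rewrite lee_fin sqr_ge0.
rewrite -esumD; first last.
- by move=> i _; rewrite -EFinM lee_fin mulr_ge0 ?sqr_ge0.
- by move=> i _; rewrite -EFinM lee_fin mulr_ge0 ?sqr_ge0.
by apply: le_esum => i _; rewrite -!EFinM -EFinD lee_fin modulusD2.
Qed.

Lemma sqsummable_submod_closed : submod_closed sqsummable.
Proof.
split=> [|c f g]; rewrite !inE.
  rewrite /sqsum esum1 ?ltry// => i _.
  by rewrite (_ : (0 : I -> R[i]) i = 0)// normr0 /= expr0n.
move=> f2 g2; apply: le_lt_trans (sqsumD _ _) _.
rewrite sqsumZ lte_add_pinfty// lte_mul_pinfty// ?mule_ge0 ?sqsum_ge0 ?lee_fin//.
by rewrite lte_mul_pinfty// lee_fin sqr_ge0.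
Qed.

HB.instance Definition _ :=
  GRing.isSubmodClosed.Build _ _ sqsummable sqsummable_submod_closed.

Record ell2 := Ell2 { ell2_fun :> I -> R[i]; _ : ell2_fun \in sqsummable }.

HB.instance Definition _ := [isSub for ell2_fun].
HB.instance Definition _ := [Choice of ell2 by <:].
HB.instance Definition _ := [SubChoice_isSubLmodule of ell2 by <:].

Implicit Types x y : ell2.

Definition l2norm x : R := Num.sqrt (fine (sqsum x)).

(* Linear in the first variable; the sum is the limit of the finite partial
   sums, in [R[i]] with its usual topology. *)
Definition l2dot x y : R[i] :=
  summability.sum (fun i => x i * (y i)^* : R[i]^o).

Lemma l2normE x : (l2norm x ^+ 2)%:E = sqsum x.
Proof.
have x2 : (sqsum x < +oo)%E := valP x.
rewrite sqr_sqrtr ?fine_ge0 ?sqsum_ge0// fineK//.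
by rewrite ge0_fin_numE ?sqsum_ge0.
Qed.

Lemma l2norm_ge0 x : 0 <= l2norm x.
Proof. exact: sqrtr_ge0. Qed.

Lemma l2normZ c x : l2norm (c *: x) = complex.Re `|c| * l2norm x.
Proof.
apply/eqP; rewrite -(@eqrXn2 _ 2) ?mulr_ge0 ?l2norm_ge0 ?modulus_ge0//.
apply/eqP/EFin_inj; rewrite l2normE exprMn EFinM l2normE.
exact: sqsumZ.
Qed.

Lemma l2normD2 x y :
  l2norm (x + y) ^+ 2 <= 2 * l2norm x ^+ 2 + 2 * l2norm y ^+ 2.
Proof.
rewrite -lee_fin EFinD (EFinM 2 (l2norm x ^+ 2)) (EFinM 2 (l2norm y ^+ 2)).
by rewrite !l2normE; exact: sqsumD.
Qed.

End L2.

Section BoundedOperators.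
Variables (R : realType) (I : choiceType).
Local Notation C := R[i].
Local Notation L2 := (ell2 R I).

Definition bounded_linear (T : L2 -> L2) : Prop :=
  linear T /\ exists M : R, forall x, l2norm (T x) <= M * l2norm x.

Lemma bounded_sq (T : L2 -> L2) (K : R) :
  (forall x, l2norm (T x) ^+ 2 <= K * l2norm x ^+ 2) ->
  exists M : R, forall x, l2norm (T x) <= M * l2norm x.
Proof.
move=> TK; exists (Num.sqrt `|K|) => x.
rewrite -(@ler_pXn2r _ 2) ?nnegrE ?mulr_ge0 ?l2norm_ge0 ?sqrtr_ge0//.
rewrite exprMn (sqr_sqrtr (normr_ge0 K)); apply: le_trans (TK x) _.
by rewrite ler_wpM2r ?sqr_ge0// ler_norm.
Qed.

Definition bounded_linear_pred : {pred L2 -> L2} :=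
  [pred T : L2 -> L2 | `[< bounded_linear T >]].

Lemma bounded_linearP (T : L2 -> L2) :
  reflect (bounded_linear T) (T \in bounded_linear_pred).
Proof. exact: asboolP. Qed.

Lemma bounded_linear_submod_closed : submod_closed bounded_linear_pred.
Proof.
split=> [|c S T].
  apply/bounded_linearP; split=> [a x y|].
    by rewrite (_ : (0 : L2 -> L2) = fun=> 0)// scaler0 addr0.
  exists 0 => x; rewrite mul0r (_ : (0 : L2 -> L2) x = 0 *: x); last by rewrite scale0r.
  by rewrite l2normZ normr0 mul0r.
move=> /bounded_linearP[Sl [M SM]] /bounded_linearP[Tl [N TN]].
apply/bounded_linearP; split.
  move=> a x y.
  rewrite (_ : (c *: S + T) = fun x => c *: S x + T x)// Sl Tl.
  by rewrite !scalerDr !scalerA [c * a]mulrC addrACA.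
apply: (@bounded_sq _ (2 * (complex.Re `|c| * M) ^+ 2 + 2 * N ^+ 2)) => x.
have e1 : l2norm (c *: S x) ^+ 2 <=
    (complex.Re `|c| * M) ^+ 2 * l2norm x ^+ 2.
  rewrite l2normZ -exprMn -mulrA lerXn2r ?nnegrE//.
  - by rewrite mulr_ge0 ?modulus_ge0 ?l2norm_ge0.
  - by rewrite mulr_ge0 ?modulus_ge0// (le_trans _ (SM x)) ?l2norm_ge0.
  - by rewrite ler_wpM2l ?modulus_ge0.
have e2 : l2norm (T x) ^+ 2 <= N ^+ 2 * l2norm x ^+ 2.
  by rewrite -exprMn lerXn2r ?nnegrE ?(le_trans _ (TN x)) ?l2norm_ge0.
apply: le_trans (l2normD2 (c *: S x) (T x)) _.
by rewrite [leRHS]mulrDl; apply: lerD; rewrite -mulrA; apply: ler_wpM2l.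
Qed.

HB.instance Definition _ := GRing.isSubmodClosed.Build _ _ bounded_linear_pred
  bounded_linear_submod_closed.

Record bop := Bop { bop_fun :> L2 -> L2; _ : bop_fun \in bounded_linear_pred }.

HB.instance Definition _ := [isSub for bop_fun].
HB.instance Definition _ := [Choice of bop by <:].
HB.instance Definition _ := [SubChoice_isSubLmodule of bop by <:].

Lemma bopP (T : bop) : bounded_linear T.
Proof. by apply/bounded_linearP; case: T. Qed.

Lemma bounded_linear_id : @id L2 \in bounded_linear_pred.
Proof.
apply/bounded_linearP; split=> //.
by exists 1 => x; rewrite mul1r.
Qed.

Lemma bounded_linear_comp (S T : bop) : S \o T \in bounded_linear_pred.
Proof.
apply/bounded_linearP.
have [[Sl [M SM]] [Tl [N TN]]] := (bopP S, bopP T); split=> [a x y|].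
  by rewrite /= Tl Sl.
apply: (@bounded_sq _ (M ^+ 2 * N ^+ 2)) => x /=.
apply: (@le_trans _ _ ((M * l2norm (T x)) ^+ 2)).
  by rewrite lerXn2r ?nnegrE ?l2norm_ge0 ?(le_trans _ (SM _)) ?l2norm_ge0.
rewrite exprMn -mulrA ler_wpM2l ?sqr_ge0// -exprMn.
by rewrite lerXn2r ?nnegrE ?l2norm_ge0 ?(le_trans _ (TN _)) ?l2norm_ge0.
Qed.

Definition bop_one := Bop bounded_linear_id.
Definition bop_mul (S T : bop) := Bop (bounded_linear_comp S T).

Let bop_mulA : associative bop_mul.
Proof. by move=> S T U; apply: val_inj. Qed.
Let bop_mul1l : left_id bop_one bop_mul.
Proof. by move=> S; apply: val_inj. Qed.
Let bop_mul1r : right_id bop_one bop_mul.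
Proof. by move=> S; apply: val_inj. Qed.
Let bop_mulDl : left_distributive bop_mul +%R.
Proof. by move=> S T U; apply: val_inj. Qed.
Let bop_mulDr : right_distributive bop_mul +%R.
Proof.
move=> S T U; apply/val_inj/funext => x /=; have [Sl _] := bopP S.
by have := Sl 1 (T x) (U x); rewrite !scale1r.
Qed.

HB.instance Definition _ := GRing.Zmodule_isPzRing.Build bop
  bop_mulA bop_mul1l bop_mul1r bop_mulDl bop_mulDr.

Definition bop_adjoint (T S : bop) : Prop :=
  forall x y, l2dot (T x) y = l2dot x (S y).

End BoundedOperators.

Section LInfty.
Variables (R : realType) (X : Type).
Local Notation C := R[i].
Implicit Types f g : X -> C.

Definition bounded_pred : {pred X -> C} :=
  [pred f : X -> C | `[< exists M : C, forall x, `|f x| <= M >]].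

Lemma bounded_predP f :
  reflect (exists M : C, forall x, `|f x| <= M) (f \in bounded_pred).
Proof. exact: asboolP. Qed.

Lemma bounded_submod_closed : submod_closed bounded_pred.
Proof.
split=> [|c f g].
  by apply/bounded_predP; exists 0 => x; rewrite normr0.
move=> /bounded_predP[M fM] /bounded_predP[N gN]; apply/bounded_predP.
exists (`|c| * M + N) => x; apply: le_trans (ler_normD _ _) _.
by rewrite lerD// normrM ler_wpM2l.
Qed.

HB.instance Definition _ := GRing.isSubmodClosed.Build _ _ bounded_pred
  bounded_submod_closed.

Record linf := Linf { linf_fun :> X -> C; _ : linf_fun \in bounded_pred }.

HB.instance Definition _ := [isSub for linf_fun].
HB.instance Definition _ := [Choice of linf by <:].
HB.instance Definition _ := [SubChoice_isSubLmodule of linf by <:].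

Lemma linfP (f : linf) : exists M : C, forall x, `|f x| <= M.
Proof. by apply/bounded_predP; case: f. Qed.

Lemma bounded_one : (fun=> 1) \in bounded_pred.
Proof. by apply/bounded_predP; exists 1 => x; rewrite normr1. Qed.

Lemma bounded_mul (f g : linf) : (fun x => f x * g x) \in bounded_pred.
Proof.
apply/bounded_predP; have [[M fM] [N gN]] := (linfP f, linfP g).
by exists (M * N) => x; rewrite normrM ler_pM.
Qed.

Definition linf_one := Linf bounded_one.
Definition linf_mul (f g : linf) : linf := Linf (bounded_mul f g).

Let linf_mulA : associative linf_mul.
Proof. by move=> f g h; apply/val_inj/funext => x /=; rewrite mulrA. Qed.
Let linf_mul1l : left_id linf_one linf_mul.
Proof. by move=> f; apply/val_inj/funext => x /=; rewrite mul1r. Qed.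
Let linf_mul1r : right_id linf_one linf_mul.
Proof. by move=> f; apply/val_inj/funext => x /=; rewrite mulr1. Qed.
Let linf_mulDl : left_distributive linf_mul +%R.
Proof. by move=> f g h; apply/val_inj/funext => x /=; rewrite mulrDl. Qed.
Let linf_mulDr : right_distributive linf_mul +%R.
Proof. by move=> f g h; apply/val_inj/funext => x /=; rewrite mulrDr. Qed.

HB.instance Definition _ := GRing.Zmodule_isPzRing.Build linf
  linf_mulA linf_mul1l linf_mul1r linf_mulDl linf_mulDr.

Definition linf_adjoint (f g : linf) : Prop := forall x, g x = (f x)^*.

End LInfty.

(* [adj a b] reads b = a^*; positivity is phi(a^* a) >= 0, and for a positive
   functional phi(1) = 1 is the same as norm 1. *)
Definition is_state (R : realType) (A : lmodType R[i]) (one : A)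
    (mul : A -> A -> A) (adj : A -> A -> Prop) (phi : {scalar A}) : Prop :=
  phi one = 1 /\ forall a b, adj a b -> 0 <= phi (mul b a).

Definition linf_state (R : realType) (X : Type) (phi : {scalar linf R X}) :=
  @is_state R (linf R X) 1 *%R (@linf_adjoint R X) phi.

Definition bop_state (R : realType) (I : choiceType) (phi : {scalar bop R I}) :=
  @is_state R (bop R I) 1 *%R (@bop_adjoint R I) phi.

Section RelativeInnerAmenability.
Variables (R : realType) (G : groupType).
Local Notation L2 := (ell2 R G).

Section Complement.
Variable H : groupClosed G.

Definition compl_type := {g : G | g \notin H}.

Lemma conj_notin (h : G) (x : compl_type) : h \in H ->
  (h^-1 * \val x * h)%g \notin H.
Proof. by move=> hH; rewrite gpredMr// gpredMl ?gpredV// (valP x). Qed.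

Definition compl_conjV (h : G) (hH : h \in H) (x : compl_type) : compl_type :=
  Sub (h^-1 * \val x * h)%g (conj_notin x hH).

Lemma bounded_conj (h : G) (hH : h \in H) (f : linf R compl_type) :
  f \o compl_conjV hH \in @bounded_pred R compl_type.
Proof.
by apply/bounded_predP; have [M fM] := linfP f; exists M => x /=.
Qed.

(* The left action of [H] on functions induced by conjugation,
   (h . f)(x) = f(h^-1 x h). *)
Definition linf_conj (h : G) (hH : h \in H) (f : linf R compl_type) :
  linf R compl_type := Linf (bounded_conj hH f).

Definition inner_amenable_rel : Prop :=
  (exists g, g \notin H) /\
  exists phi : {scalar linf R compl_type}, linf_state phi /\
    forall (h : G) (hH : h \in H) f, phi (linf_conj hH f) = phi f.

End Complement.

Lemma conj_bij (g : G) :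
  set_bij [set: G] [set: G] (fun x => g^-1 * x * g)%g.
Proof.
rewrite setTT_bijective.
exists (fun x => g * x * g^-1)%g => x.
  by rewrite !mulgA mulgV mul1g mulgK.
by rewrite !mulgA mulVg mul1g mulgVK.
Qed.

Lemma sqsum_conj (g : G) (x : G -> R[i]) :
  sqsum (fun k => x (g^-1 * k * g)%g) = sqsum x.
Proof.
by rewrite [RHS]/sqsum (reindex_esum setT setT (fun k => g^-1 * k * g)%g)//;
  exact: conj_bij.
Qed.

Lemma conj_sqsummable (g : G) (x : L2) :
  (fun k => x (g^-1 * k * g)%g) \in @sqsummable R G.
Proof. by rewrite inE sqsum_conj; exact: (valP x). Qed.

Definition conj_fun (g : G) (x : L2) : L2 := Ell2 (conj_sqsummable g x).

Lemma conj_bounded (g : G) : conj_fun g \in @bounded_linear_pred R G.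
Proof.
apply/bounded_linearP; split=> [a x y|]; first exact/val_inj.
by exists 1 => x; rewrite mul1r /l2norm sqsum_conj.
Qed.

Definition conj_rep (g : G) : bop R G := Bop (conj_bounded g).

Lemma restr_le (A : {pred G}) (x : G -> R[i]) :
  (sqsum (fun k => if k \in A then x k else 0%R) <= sqsum x)%E.
Proof.
apply: le_esum => k _; rewrite lee_fin; case: ifP => // _.
by rewrite normr0 /= expr0n sqr_ge0.
Qed.

Lemma restr_sqsummable (A : {pred G}) (x : L2) :
  (fun k => if k \in A then x k else 0) \in @sqsummable R G.
Proof. by rewrite inE; apply: le_lt_trans (restr_le _ _) (valP x). Qed.

Definition restr_fun (A : {pred G}) (x : L2) : L2 := Ell2 (restr_sqsummable A x).

Lemma restr_bounded (A : {pred G}) : restr_fun A \in @bounded_linear_pred R G.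
Proof.
apply/bounded_linearP; split=> [a x y|].
  apply/val_inj/funext => k /=.
  rewrite [RHS](_ : _ = a * restr_fun A x k + restr_fun A y k)//=.
  by case: ifP => // _; rewrite mulr0 addr0.
apply: (@bounded_sq _ _ _ 1) => x.
by rewrite mul1r -lee_fin !l2normE restr_le.
Qed.

(* The orthogonal projection of l2(G) onto l2(A). *)
Definition restr_proj (A : {pred G}) : bop R G := Bop (restr_bounded A).

Definition supp (x : L2) : set G := [set g | x g != 0].

End RelativeInnerAmenability.

Definition directed (D : Type) (le : D -> D -> Prop) : Prop :=
  [/\ inhabited D, forall m, le m m,
      forall m n p, le m n -> le n p -> le m p &
      forall m n, exists p, le m p /\ le n p].

(* The filter of tails of a net: [f @ net_filter le --> l] is convergence of
   the net [f]. *)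
Definition net_filter (D : Type) (le : D -> D -> Prop) : set_system D :=
  filter_from setT (fun m => [set n | le m n]).

(* Main.v *)
From HB Require Import structures.
Require Import Defs.
From mathcomp Require Import all_boot all_order all_algebra.
From mathcomp Require Import finmap.
From mathcomp Require Import all_classical all_reals all_analysis.
From mathcomp Require Import complex.
From mathcomp Require Import ring lra.
From mathcomp.analysis.showcase Require summability.

Import Order.TTheory GRing.Theory Num.Theory numFieldNormedType.Exports.

Local Open Scope classical_set_scope.
Local Open Scope ring_scope.

(** Write alpha(h) for conjugation by h and call a vector of l2(G) off H when
    its support avoids H.  The three conditions are linked in a cycle.

    From a mean to approximately invariant vectors.  It is enough to treat
    finitely many h_1, ..., h_n in H and one eps > 0, since a net indexed by
    such data then does the job.  If every unit vector off H were moved by at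
    least eps by some alpha(h_i), then applying this to square roots of
    nonnegative elements mu of l1(G) carried by the complement of H, and using
    |sqrt a - sqrt b|^2 <= |a - b|, would give
      eps^2 ||mu||_1 <= sum_i ||h_i mu - mu||_1   ([displacement_ge]).
    A Hahn-Banach argument, in the form of [mazur_orlicz], then produces a
    linear functional on n copies of l1(G), that is, bounded functions
    f_1, ..., f_n, for which
      eps^2 <= sum_i (f_i(h_i x h_i^-1) - f_i(x))   for every x outside H,
    and a conjugation invariant mean evaluated on this inequality says
    eps^2 <= 0 ([mean_approximate_finite]).

    From approximately invariant vectors to a state.  The limit of the vector
    states T |-> <T xi_n, xi_n> along an ultrafilter finer than the net is a
    state; it kills e_H because the xi_n are off H, and it kills
    (alpha(h) - 1)^* (alpha(h) - 1), so it takes the value 1 at alpha(h) by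
    Cauchy-Schwarz ([approximate_to_state]).

    From a state to a mean.  Restrict the state phi to the multiplication
    operators M_f by bounded functions on the complement of H.  Since
    phi(alpha(h)) = 1, the operator alpha(h) - 1 is a null vector for phi, so
    Cauchy-Schwarz lets alpha(h) be dropped from both ends of
    M_(h.f) = alpha(h) M_f alpha(h)^* inside phi ([state_to_mean]).

    Cauchy-Schwarz is used only through [state_null_orthogonal], its
    degenerate case.  The inner product of l2 is a limit of partial sums; the
    polarization identity reduces its existence to that of the norms, and shows
    that it is preserved by conjugations without reindexing any sum. *)

(** * Dominated extension of linear functionals *)

Section MazurOrlicz.
Context {R : realType} {E : lmodType R}.
Implicit Types (q : E -> R) (K : set (E * R)) (x y v : E).

Definition sublinear q :=
  (forall x y, q (x + y) <= q x + q y) /\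
  (forall t x, 0 < t -> q (t *: x) <= t * q x).

Lemma sublinearZ q t x : sublinear q -> 0 < t -> q (t *: x) = t * q x.
Proof.
move=> [_ qZ] t0; apply/eqP; rewrite eq_le qZ//=.
have := qZ t^-1 (t *: x); rewrite invr_gt0 => /(_ t0).
by rewrite scalerA mulVf ?gt_eqF// scale1r -ler_pdivrMl ?invr_gt0// invrK.
Qed.

Lemma sublinear0 q : sublinear q -> q 0 = 0.
Proof.
move=> qs; have := @sublinearZ q 2 0 qs (ltr0Sn _ _).
rewrite scaler0 => h; lra.
Qed.

Definition cone K :=
  [/\ K (0, 0), forall e e', K e -> K e' -> K (e.1 + e'.1, e.2 + e'.2) &
      forall t e, 0 < t -> K e -> K (t *: e.1, t * e.2)].

(** The largest sublinear functional below q that is at most - r at - e for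
    each (e, r) in K, when K is a cone on which r <= q e.  A linear functional
    below it is therefore at least r at e. *)
Definition minorant q K v : R := inf [set q (v + e.1) - e.2 | e in K].

Section Minorant.
Variables (q : E -> R) (K : set (E * R)).
Hypotheses (qs : sublinear q) (Kc : cone K).
Hypothesis qK : forall e, K e -> e.2 <= q e.1.

Let minorant_has_inf v : has_inf [set q (v + e.1) - e.2 | e in K].
Proof.
have [K0 _ _] := Kc; split; first by exists (q (v + 0) - 0), (0, 0).
exists (- q (- v)) => _ [e Ke <-].
have := qs.1 (v + e.1) (- v); rewrite addrAC subrr add0r => h.
have := qK _ Ke; lra.
Qed.

Lemma minorant_ge v e : K e -> minorant q K v <= q (v + e.1) - e.2.
Proof. by move=> Ke; apply: ge_inf; [exact: (minorant_has_inf v).2|exists e]. Qed.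

Lemma le_minorant v (c : R) :
  (forall e, K e -> c <= q (v + e.1) - e.2) -> c <= minorant q K v.
Proof.
move=> h; apply: lb_le_inf; first exact: (minorant_has_inf v).1.
by move=> _ [e Ke <-]; exact: h.
Qed.

Lemma minorant_le v : minorant q K v <= q v.
Proof. by have [K0 _ _] := Kc; have := minorant_ge v _ K0; rewrite addr0 subr0. Qed.

Lemma minorant_opp e : K e -> minorant q K (- e.1) <= - e.2.
Proof.
by move=> /minorant_ge-/(_ (- e.1)); rewrite addNr sublinear0// sub0r.
Qed.

Lemma minorant_sublinear : sublinear (minorant q K).
Proof.
have [_ KD KZ] := Kc; split=> [x y|t x t0].
  rewrite -lerBlDr; apply: le_minorant => e Ke.
  rewrite lerBlDr [leRHS]addrC -lerBlDr; apply: le_minorant => e' Ke'.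
  have := minorant_ge (x + y) _ (KD _ _ Ke Ke').
  have := qs.1 (x + e.1) (y + e'.1); rewrite addrACA /= => h1 h2; lra.
rewrite -ler_pdivrMl//; apply: le_minorant => e Ke.
rewrite ler_pdivrMl//; apply: le_trans (minorant_ge _ _ (KZ _ _ t0 Ke)) _.
by rewrite /= -scalerDr sublinearZ// mulrBr.
Qed.

End Minorant.

(** Zorn's lemma; the pointwise infimum of a chain is again subadditive because
    of any two members of the chain one lies below the other. *)
Lemma exists_minimal_sublinear q : sublinear q ->
  exists2 p, sublinear p /\ (forall x, p x <= q x) &
    forall p', sublinear p' -> (forall x, p' x <= p x) -> p' = p.
Proof.
move=> qs; pose T := {p : E -> R | sublinear p /\ forall x, p x <= q x}.
pose ord (a b : T) := `[< forall x, sval b x <= sval a x >].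
have [| | | |[p [ps pq]] pmin] := @Zorn T ord.
- by move=> a; apply/asboolP.
- move=> a b c /asboolP ab /asboolP bc; apply/asboolP => x.
  exact: le_trans (bc x) (ab x).
- move=> [a a'] [b b'] /asboolP /= ab /asboolP /= ba; apply: eq_exist => /=.
  by apply/funext => x; apply/eqP; rewrite eq_le; apply/andP; split; [exact: ba|exact: ab].
- move=> A Atot; have [->|/set0P[a Aa]] := eqVneq A set0.
    by exists (exist _ q (conj qs (fun x => lexx _))).
  pose r x := inf [set sval b x | b in A].
  have rhas x : has_inf [set sval b x | b in A].
    split; first by exists (sval a x), a.
    exists (- q (- x)) => _ [[b [bs bq]] _ <-] /=.
    have := bs.1 x (- x); rewrite subrr sublinear0//; have := bq (- x); lra.
  have rle x b : A b -> r x <= sval b x.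
    by move=> Ab; apply: ge_inf; [exact: (rhas x).2|exists b].
  have ler x c : (forall b, A b -> c <= sval b x) -> c <= r x.
    move=> h; apply: lb_le_inf; first exact: (rhas x).1.
    by move=> _ [b Ab <-]; exact: h.
  have rs : sublinear r.
    split=> [x y|t x t0].
      rewrite -lerBlDr; apply: (ler) => b Ab.
      rewrite lerBlDr [leRHS]addrC -lerBlDr; apply: (ler) => c Ac.
      have [/asboolP cb|/asboolP bc] := Atot _ _ Ab Ac.
        have := rle (x + y) _ Ac; have := (svalP c).1.1 x y; have := cb x; lra.
      have := rle (x + y) _ Ab; have := (svalP b).1.1 x y; have := bc y; lra.
    rewrite -ler_pdivrMl//; apply: (ler) => b Ab.
    rewrite ler_pdivrMl//; apply: le_trans (rle _ _ Ab) _.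
    exact: (svalP b).1.2.
  have rq x : r x <= q x by apply: le_trans (rle x _ Aa) _; exact: (svalP a).2.
  by exists (exist _ r (conj rs rq)) => s As; apply/asboolP => x; exact: rle.
exists p => // p' p's p'p.
have p'q x : p' x <= q x by exact: le_trans (p'p x) (pq x).
suff /pmin/(congr1 sval) : ord (exist _ p (conj ps pq)) (exist _ p' (conj p's p'q)) by [].
exact/asboolP.
Qed.

(** Lowering q by means of the ray through (y, q y) gives a sublinear functional
    at most - q y at - y; by minimality that functional is q itself. *)
Lemma minimal_sublinear_odd q : sublinear q ->
  (forall p, sublinear p -> (forall x, p x <= q x) -> p = q) ->
  forall y, q (- y) = - q y.
Proof.
move=> qs qmin y.
pose K := [set e : E * R | exists2 t, 0 <= t & e = (t *: y, t * q y)].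
have Kc : cone K.
  split=> [|_ _ [t t0 ->] [s s0 ->]|t _ t0 [s s0 ->]] /=.
  - by exists 0; rewrite ?scale0r ?mul0r.
  - by exists (t + s); rewrite ?addr_ge0// scalerDl mulrDl.
  - by exists (t * s); rewrite ?mulr_ge0 ?(ltW t0)// scalerA mulrA.
have qK e : K e -> e.2 <= q e.1.
  move=> [t + ->] /=; rewrite le_eqVlt => /predU1P[<-|t0].
    by rewrite scale0r mul0r sublinear0.
  by rewrite sublinearZ.
have Ky : K (y, q y) by exists 1; rewrite ?scale1r ?mul1r.
have := minorant_opp _ _ qs Kc qK _ Ky.
rewrite (qmin _ (minorant_sublinear _ _ qs Kc qK) (minorant_le _ _ qs Kc qK)) /= => h.
by have := qs.1 y (- y); rewrite subrr sublinear0// => h'; lra.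
Qed.

(** Lower q along K, then take a minimal sublinear functional below the result:
    being odd, it is linear. *)
Theorem mazur_orlicz q K : sublinear q -> cone K ->
  (forall e, K e -> e.2 <= q e.1) ->
  exists L : {scalar E}, (forall x, L x <= q x) /\
    (forall e, K e -> e.2 <= L e.1).
Proof.
move=> qs Kc qK.
have [L [Ls Lq] Lmin] := exists_minimal_sublinear _ (minorant_sublinear _ _ qs Kc qK).
have LN := minimal_sublinear_odd _ Ls Lmin.
have LD x y : L (x + y) = L x + L y.
  apply/eqP; rewrite eq_le Ls.1/=.
  have := Ls.1 (- x) (- y); rewrite -opprD !LN; lra.
have LZ t x : L (t *: x) = t * L x.
  have [t0|t0|<-] := ltgtP 0 t; first exact: sublinearZ.
    rewrite -[t]opprK scaleNr LN mulNr sublinearZ// oppr_gt0//.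
  by rewrite scale0r mul0r sublinear0.
have Llin : linear_for *%R L by move=> t x y; rewrite LD LZ.
pose Lm := GRing.isLinear.Build R E R *%R L Llin.
pose LL : {scalar E} := HB.pack L Lm.
exists LL; split=> [x|e Ke] /=.
  exact: le_trans (Lq x) (minorant_le _ _ qs Kc qK x).
have := Lq (- e.1); rewrite LN; have := minorant_opp _ _ qs Kc qK _ Ke; lra.
Qed.

End MazurOrlicz.

(** * Absolutely summable functions *)

Section L1.
Variables (R : realType) (I : choiceType).
Implicit Types (f g : I -> R) (c : R).

Definition l1sum f : \bar R := \esum_(i in setT) (`|f i|)%:E.

Definition l1summable : {pred I -> R} := [pred f : I -> R | (l1sum f < +oo)%E].

Lemma l1sum_ge0 f : (0 <= l1sum f)%E.
Proof. by apply: esum_ge0 => i _; rewrite lee_fin. Qed.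

Lemma l1sumZ c f : l1sum (c *: f) = (`|c|%:E * l1sum f)%E.
Proof.
rewrite /l1sum -esumZ//; apply: eq_esum => i _.
by rewrite -EFinM -normrM.
Qed.

Lemma l1sumD f g : (l1sum (f + g)%R <= l1sum f + l1sum g)%E.
Proof.
rewrite /l1sum -esumD//; apply: le_esum => i _.
by rewrite -EFinD lee_fin ler_normD.
Qed.

Lemma l1summable_submod_closed : submod_closed l1summable.
Proof.
split=> [|c f g]; rewrite !inE.
  by rewrite /l1sum esum1 ?ltry// => i _; rewrite normr0.
move=> fs gs; apply: le_lt_trans (l1sumD _ _) _.
by rewrite lte_add_pinfty// l1sumZ lte_mul_pinfty// lee_fin.
Qed.

HB.instance Definition _ :=
  GRing.isSubmodClosed.Build _ _ l1summable l1summable_submod_closed.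

Record ell1 := Ell1 { ell1_fun :> I -> R; _ : ell1_fun \in l1summable }.

HB.instance Definition _ := [isSub for ell1_fun].
HB.instance Definition _ := [Choice of ell1 by <:].
HB.instance Definition _ := [SubChoice_isSubLmodule of ell1 by <:].

Implicit Types x y : ell1.

Definition l1norm x : R := fine (l1sum x).

Lemma l1normE x : (l1norm x)%:E = l1sum x.
Proof. by rewrite fineK// ge0_fin_numE ?l1sum_ge0//; exact: (valP x). Qed.

Lemma l1norm_ge0 x : 0 <= l1norm x.
Proof. by rewrite -lee_fin l1normE l1sum_ge0. Qed.

Lemma l1normZ c x : l1norm (c *: x) = `|c| * l1norm x.
Proof. by apply: EFin_inj; rewrite EFinM !l1normE; exact: l1sumZ. Qed.

Lemma l1norm0 : l1norm 0 = 0.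
Proof. by have := l1normZ 0 0; rewrite scale0r normr0 mul0r. Qed.

Lemma l1normD x y : l1norm (x + y) <= l1norm x + l1norm y.
Proof. by rewrite -lee_fin EFinD !l1normE; exact: l1sumD. Qed.

Lemma l1normD_nneg x y : (forall i, 0 <= x i) -> (forall i, 0 <= y i) ->
  l1norm (x + y) = l1norm x + l1norm y.
Proof.
move=> x0 y0; apply: EFin_inj; rewrite EFinD !l1normE /l1sum -esumD//.
apply: eq_esum => i _; rewrite -EFinD -[(x + y) i]/(x i + y i).
by rewrite !ger0_norm ?addr_ge0.
Qed.

Lemma l1sum_dirac (a : I) : l1sum (fun i => (i == a)%:R) = 1%E.
Proof.
rewrite /l1sum (_ : (fun i => _) =
    (fun i => if i \in [set a] then 1%E else 0%E)).
  by rewrite -esum_mkcond esum_set1.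
apply/funext => i; rewrite normr_nat.
have [->|ia] := eqVneq i a; first by rewrite mem_set.
by rewrite memNset//=; apply/eqP.
Qed.

Lemma dirac_l1summable (a : I) : (fun i => (i == a)%:R) \in l1summable.
Proof. by rewrite inE l1sum_dirac ltry. Qed.

Definition l1dirac a : ell1 := Ell1 _ (dirac_l1summable a).

Lemma l1norm_dirac a : l1norm (l1dirac a) = 1.
Proof. by apply: EFin_inj; rewrite l1normE l1sum_dirac. Qed.

End L1.
Arguments l1sum {R I} f.
Arguments l1norm {R I} x.
Arguments Ell1 {R I} _ _.
Arguments l1dirac {R I} a.

Section SquareRoot.
Local Open Scope complex_scope.
Local Open Scope ring_scope.
Context {R : realType} {G : groupType}.
Implicit Types (mu : ell1 R G).

Lemma sqsum_sqrt (mu : G -> R) : (forall k, 0 <= mu k) ->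
  sqsum (fun k => (Num.sqrt (mu k))%:C) = l1sum mu.
Proof.
move=> mu0; apply: eq_esum => k _.
rewrite ger0_norm ?ler0c ?sqrtr_ge0//= sqr_sqrtr//.
by rewrite ger0_norm.
Qed.

Lemma sqrt_sqsummable mu :
  (fun k => (Num.sqrt `|mu k|)%:C) \in @sqsummable R G.
Proof.
rewrite inE sqsum_sqrt// /l1sum.
under eq_esum do rewrite normr_id; exact: (valP mu).
Qed.

(** The absolute value only serves to make the square root total on l1; the
    definition is meant for nonnegative functions. *)
Definition l1sqrt mu : ell2 R G := Ell2 (sqrt_sqsummable mu).

Lemma l2norm_sqrt mu : l2norm (l1sqrt mu) ^+ 2 = l1norm mu.
Proof.
apply: EFin_inj; rewrite l2normE l1normE sqsum_sqrt// /l1sum.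
by under eq_esum do rewrite normr_id.
Qed.

(** (s - t)^2 <= (s - t) (s + t) for 0 <= t <= s. *)
Lemma sqr_sqrtB (a b : R) : 0 <= a -> 0 <= b ->
  (Num.sqrt a - Num.sqrt b) ^+ 2 <= `|a - b|.
Proof.
wlog ab : a b / b <= a => [hw a0 b0|a0 b0].
  have [ab|/ltW ab] := leP b a; first exact: hw.
  by rewrite -sqrrN opprB distrC hw.
rewrite ger0_norm ?subr_ge0// -{2}(sqr_sqrtr a0) -{2}(sqr_sqrtr b0).
have := sqrtr_ge0 b; have : Num.sqrt b <= Num.sqrt a by rewrite ler_wsqrtr.
by set s := Num.sqrt a; set t := Num.sqrt b => ts t0; nra.
Qed.

Lemma l1sum_conj (g : G) (mu : G -> R) :
  l1sum (fun k => mu (g^-1 * k * g)%g) = l1sum mu.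
Proof.
by rewrite [RHS]/l1sum (reindex_esum setT setT (fun k => g^-1 * k * g)%g)//;
  exact: conj_bij.
Qed.

Lemma conj_l1summable (g : G) mu :
  (fun k => mu (g^-1 * k * g)%g) \in l1summable R G.
Proof. by rewrite inE l1sum_conj; exact: (valP mu). Qed.

Definition l1conj (g : G) mu : ell1 R G := Ell1 _ (conj_l1summable g mu).

(** Almost invariance in l1 passes to square roots in l2. *)
Lemma l1sqrt_conj g mu : l2norm (conj_rep R g (l1sqrt mu) - l1sqrt mu) ^+ 2 <=
  l1norm (l1conj g mu - mu).
Proof.
rewrite -lee_fin l2normE l1normE; apply: le_esum => k _; rewrite lee_fin.
rewrite -[X in complex.Re `|X|]/((Num.sqrt `|mu (g^-1 * k * g)%g|)%:C - (Num.sqrt `|mu k|)%:C).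
rewrite -rmorphB /= expr0n addr0 sqrtr_sqr real_normK ?num_real//.
apply: le_trans (sqr_sqrtB _ _ _ _) _ => //.
exact: ler_dist_dist.
Qed.

End SquareRoot.

(** * From an invariant mean to almost invariant vectors *)

Section MeanToApproximate.
Local Open Scope complex_scope.
Local Open Scope ring_scope.
Context {R : realType} {G : groupType} {H : groupClosed G}.
Local Notation X := (compl_type H).

Section FinitelyMany.
Context {n : nat}.
Variables (h : 'I_n -> G) (eps : R).
Local Notation E := ('I_n -> ell1 R G).

Definition l1norm_sum (v : E) : R := \sum_i l1norm (v i).

Lemma l1norm_sum_sublinear : sublinear l1norm_sum.
Proof.
split=> [v w|t v t0].
  by rewrite -big_split/=; apply: ler_sum => i _; exact: l1normD.
rewrite /l1norm_sum mulr_sumr; apply: ler_sum => i _.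
by rewrite l1normZ gtr0_norm.
Qed.

Definition displacement (mu : ell1 R G) : E := fun i => l1conj (h i) mu - mu.

(** The cone to which the extension theorem is applied: a functional above it is
    at least eps^2 on the displacement of each point mass off H. *)
Definition displacement_cone : set (E * R) :=
  [set (displacement mu, eps ^+ 2 * l1norm mu) | mu in
    [set mu : ell1 R G | (forall k, 0 <= mu k) /\ forall k, k \in H -> mu k = 0]].

Lemma displacementD mu nu :
  displacement (mu + nu) = displacement mu + displacement nu.
Proof.
by apply/funext => i; apply/val_inj/funext => k; rewrite /= opprD addrACA.
Qed.

Lemma displacementZ t mu : displacement (t *: mu) = t *: displacement mu.
Proof.
apply/funext => i.
rewrite -[RHS]/(t *: (l1conj (h i) mu - mu)) scalerBr.
exact/val_inj.
Qed.

Lemma displacement_coneP : cone displacement_cone.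
Proof.
split.
- exists 0; first by split.
  have d0 : displacement 0 = 0.
    by have := displacementZ 0 0; rewrite !scale0r.
  by rewrite d0 l1norm0 mulr0.
- move=> _ _ [mu [mu0 muH] <-] [nu [nu0 nuH] <-] /=; exists (mu + nu).
    split=> k; first by rewrite -[leRHS]/(mu k + nu k) addr_ge0.
    by move=> kH; rewrite -[LHS]/(mu k + nu k) muH// nuH// addr0.
  by rewrite displacementD l1normD_nneg// mulrDr.
- move=> t _ t0 [mu [mu0 muH] <-] /=; exists (t *: mu).
    split=> k; first by rewrite -[leRHS]/(t * mu k) mulr_ge0// ltW.
    by move=> kH; rewrite -[LHS]/(t * mu k) muH// mulr0.
  by rewrite displacementZ l1normZ gtr0_norm// mulrCA.
Qed.

(** The unit vector to test is the normalized square root of mu.  The left-hand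
    side scales like the square of its norm, so the factor eps enters as eps^2. *)
Lemma displacement_ge : 0 < eps ->
  (forall xi : ell2 R G, l2norm xi = 1 -> supp xi `<=` [set g | g \notin H] ->
    exists i, eps <= l2norm (conj_rep R (h i) xi - xi)) ->
  forall e, displacement_cone e -> e.2 <= l1norm_sum e.1.
Proof.
move=> eps0 far _ [mu [mu0 muH] <-] /=; set eta := l1sqrt mu.
have [eta0|eta0] := eqVneq (l2norm eta) 0.
  rewrite -l2norm_sqrt -/eta eta0 expr0n mulr0.
  by apply: sumr_ge0 => i _; exact: l1norm_ge0.
have etap : 0 < l2norm eta by rewrite lt_def eta0 l2norm_ge0.
have normZ (t : R) (x : ell2 R G) : 0 < t -> l2norm (t%:C *: x) = t * l2norm x.
  by move=> t0; rewrite l2normZ ger0_norm ?ler0c// ltW.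
have [||i] := far ((l2norm eta)^-1%:C *: eta).
- by rewrite normZ ?invr_gt0// mulVf.
- move=> k; apply: contraPP => /= /negP; rewrite negbK => kH; apply/negP; rewrite negbK.
  rewrite -[X in X == _]/((l2norm eta)^-1%:C * (Num.sqrt `|mu k|)%:C).
  by rewrite muH// normr0 sqrtr0 mulr0.
have -> : conj_rep R (h i) ((l2norm eta)^-1%:C *: eta) - (l2norm eta)^-1%:C *: eta =
    (l2norm eta)^-1%:C *: (conj_rep R (h i) eta - eta).
  by rewrite [RHS]scalerBr; congr (_ - _); exact/val_inj.
rewrite normZ ?invr_gt0// ler_pdivlMl// => le_eps.
rewrite -l2norm_sqrt -exprMn mulrC.
apply: (@le_trans _ _ (l1norm (l1conj (h i) mu - mu))).
  apply: le_trans (l1sqrt_conj _ _).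
  by rewrite lerXn2r ?nnegrE ?mulr_ge0 ?l2norm_ge0// ltW.
rewrite /l1norm_sum (bigD1 i)//= lerDl; apply: sumr_ge0 => j _; exact: l1norm_ge0.
Qed.

Definition slot (i : 'I_n) (u : ell1 R G) : E := fun j => if j == i then u else 0.

Lemma slotN i u : slot i (- u) = - slot i u.
Proof.
by apply/funext => j; rewrite -[RHS]/(- (slot i u j)) /slot; case: ifP; rewrite ?oppr0.
Qed.

Lemma slotB i u v : slot i (u - v) = slot i u - slot i v.
Proof.
apply/funext => j; rewrite -[RHS]/(slot i u j - slot i v j) /slot.
by case: ifP; rewrite ?subr0.
Qed.

Lemma l1norm_slot i u : l1norm_sum (slot i u) = l1norm u.
Proof.
rewrite /l1norm_sum (bigD1 i)//= big1 ?addr0 /slot ?eqxx// => j /negPf ->.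
exact: l1norm0.
Qed.

Lemma displacement_dirac x : displacement (l1dirac x) =
  \sum_i (slot i (l1dirac (h i * x * (h i)^-1)%g) - slot i (l1dirac x)).
Proof.
have slot_sum (v : E) : v = \sum_i slot i (v i).
  apply/funext => j; rewrite fct_sumE (bigD1 j)//= /slot eqxx big1 ?addr0// => i.
  by rewrite eq_sym => /negPf ->.
rewrite [LHS]slot_sum; apply: eq_bigr => i _; rewrite -slotB; congr (slot i (_ - _)).
apply/val_inj/funext => k /=; congr (nat_of_bool _)%:R.
by apply/eqP/eqP => [<-|->]; rewrite !mulgA ?mulgV ?mulVg ?mul1g ?mulgK ?mulgVK.
Qed.

End FinitelyMany.

(** A nonnegative function is the square of its square root, which is bounded
    and self-adjoint. *)
Lemma mean_ge0 (phi : {scalar linf R X}) (f : linf R X) : linf_state phi ->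
  (forall x, 0 <= f x) -> 0 <= phi f.
Proof.
move=> [_ pos] f0.
have sb : (fun x => sqrtC (f x)) \in @bounded_pred R X.
  apply/bounded_predP; have [M fM] := linfP f; exists (1 + M) => x.
  rewrite ger0_norm ?sqrtC_ge0//.
  have s0 : 0 <= sqrtC (f x) by rewrite sqrtC_ge0.
  have := fM x; rewrite ger0_norm// => fxM.
  have M0 : 0 <= M by exact: le_trans (f0 x) fxM.
  rewrite -(@ler_pXn2r _ 2) ?nnegrE ?addr_ge0// sqrtCK (le_trans fxM)//.
  rewrite sqrrD expr1n mul1r mulr2n -subr_ge0.
  rewrite (_ : _ - M = 1 + M + M ^+ 2); last by ring.
  by rewrite !addr_ge0// exprn_ge0.
pose s : linf R X := Linf sb.
have -> : f = s * s.
  by apply/val_inj/funext => x /=; rewrite -expr2 sqrtCK.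
apply: pos => x; rewrite /= conj_Creal// ger0_real// sqrtC_ge0//.
Qed.

(** The functional lam given by [mazur_orlicz] is bounded by the l1-norm, so its
    values f i on point masses are bounded functions of the point; the mean of
    the sum over i of the differences between conjugates of f i and f i is 0,
    although this sum is at least eps^2 everywhere. *)
Lemma mean_approximate_finite (n : nat) (h : 'I_n -> G) (eps : R) :
  inner_amenable_rel R H -> (forall i, h i \in H) -> 0 < eps ->
  exists xi : ell2 R G, [/\ l2norm xi = 1, supp xi `<=` [set g | g \notin H] &
    forall i, l2norm (conj_rep R (h i) xi - xi) < eps].
Proof.
move=> [_ [phi [phiS phiinv]]] hH eps0; apply: contrapT => noxi.
have far (xi : ell2 R G) : l2norm xi = 1 -> supp xi `<=` [set g | g \notin H] ->
    exists i, eps <= l2norm (conj_rep R (h i) xi - xi).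
  move=> xi1 xiH; apply: contrapT => nofar; apply: noxi; exists xi; split=> // i.
  by rewrite ltNge; apply/negP => le_eps; apply: nofar; exists i.
have [L [Lle Lge]] := mazur_orlicz _ _ l1norm_sum_sublinear (displacement_coneP h eps)
  (displacement_ge h eps eps0 far).
pose lam (v : 'I_n -> ell1 R G) : R := L v.
pose f i (y : G) : R := lam (slot i (l1dirac y)).
have lamE x : lam (displacement h (l1dirac x)) =
    \sum_i (f i (h i * x * (h i)^-1)%g - f i x).
  rewrite displacement_dirac /lam linear_sum; apply: eq_bigr => i _.
  exact: linearB.
have fb i : (fun x : X => (f i (val x))%:C) \in @bounded_pred R X.
  apply/bounded_predP; exists 1 => x.
  rewrite normc_def /= expr0n addr0 sqrtr_sqr lecR ler_norml.
  apply/andP; split; last by apply: le_trans (Lle _) _; rewrite l1norm_slot l1norm_dirac.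
  rewrite lerNl /f /lam -linearN -slotN; apply: le_trans (Lle _) _.
  by rewrite l1norm_slot -scaleN1r l1normZ normrN1 mul1r l1norm_dirac.
have hHV i : (h i)^-1%g \in H by rewrite gpredV.
pose F i : linf R X := Linf (fb i).
pose g : linf R X :=
  \sum_i (linf_conj (hHV i) (F i) - F i) - (eps ^+ 2)%:C *: (1 : linf R X).
have phig : phi g = - (eps ^+ 2)%:C.
  rewrite /g linearB linear_sum big1 => [|i _]; last by rewrite linearB /= phiinv subrr.
  by rewrite linearZ /= phiS.1 mulr1 sub0r.
have valD : {morph val : a b / (a : linf R X) + b >-> (a + b : X -> R[i])} by [].
have rB (a b : R) : (a - b)%:C = a%:C - b%:C :> R[i] by exact: rmorphB.
have : 0 <= phi g.
  apply: mean_ge0 => // x.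
  have -> : g x = (lam (displacement h (l1dirac (val x))) - eps ^+ 2)%:C.
    rewrite -[LHS]/(val (\sum_i (linf_conj (hHV i) (F i) - F i)) x - (eps ^+ 2)%:C * 1).
    rewrite mulr1 rB; congr (_ - _).
    rewrite (big_morph val valD (erefl _)) fct_sumE lamE rmorph_sum.
    apply: eq_bigr => i _; rewrite [RHS]rB.
    rewrite -[LHS]/((f i ((h i)^-1^-1 * val x * (h i)^-1)%g)%:C - (f i (val x))%:C).
    by rewrite invgK.
  rewrite ler0c subr_ge0.
  have := Lge (displacement h (l1dirac (val x)), eps ^+ 2 * l1norm (l1dirac (val x))).
  rewrite l1norm_dirac mulr1; apply; exists (l1dirac (val x)); last first.
    by rewrite l1norm_dirac mulr1.
  split=> k /=; first by rewrite ler0n.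
  by move=> kH; case: eqP => // kx; move: (valP x) kH; rewrite kx => /negPf ->.
by rewrite phig oppr_ge0 (lecR _ 0) leNgt exprn_gt0.
Qed.

(** The net is indexed by pairs of a finite list of elements of G and a
    tolerance 1 / (m + 1). *)
Lemma mean_to_approximate : inner_amenable_rel R H ->
   exists (D : Type) (le : D -> D -> Prop) (xi : D -> ell2 R G),
     [/\ directed le,
         forall n, l2norm (xi n) = 1,
         forall n, supp (xi n) `<=` [set g | g \notin H] &
         forall h, h \in H ->
           l2norm (conj_rep R h (xi n) - xi n) @[n --> net_filter le] -->
             (0 : R)].
Proof.
move=> amen.
have ex (d : seq G * nat) : exists xi : ell2 R G,
    [/\ l2norm xi = 1, supp xi `<=` [set g | g \notin H] &
      forall h, h \in H -> h \in d.1 ->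
        l2norm (conj_rep R h xi - xi) < d.2.+1%:R^-1].
  pose s := [seq h <- d.1 | h \in H].
  have [||xi [xi1 xiH xis]] := @mean_approximate_finite (size s)
      (fun i => tnth (in_tuple s) i) d.2.+1%:R^-1 amen.
  - by move=> i; have := mem_tnth i (in_tuple s); rewrite mem_filter => /andP[].
  - by rewrite invr_gt0.
  exists xi; split=> // h hH hd.
  have /tnthP[i ->] : h \in in_tuple s by rewrite mem_filter hH.
  exact: xis.
have [xi xiP] := choice ex.
exists (seq G * nat)%type, (fun d d' => {subset d.1 <= d'.1} /\ (d.2 <= d'.2)%N), xi.
split=> [|d|d|h hH]; try by have [] := xiP d.
  split.
  - by constructor; exact: ([::], 0%N).
  - by move=> a; split.
  - by move=> a b c [ab ab'] [bc bc']; split; [move=> x /ab/bc|exact: leq_trans bc'].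
  - move=> a b; exists (a.1 ++ b.1, maxn a.2 b.2) => /=.
    split; split; rewrite ?leq_maxl ?leq_maxr// => x xa; rewrite mem_cat xa ?orbT//.
move=> V /nbhs_ballP[e /= e0 eV].
pose N := Num.truncn e^-1.
exists ([:: h], N) => // d [hd Nd]; apply: eV.
have [_ _ /(_ h hH (hd h (mem_head _ _))) lt] := xiP d.
rewrite /ball /= sub0r normrN ger0_norm ?l2norm_ge0//.
apply: lt_le_trans lt _; rewrite invf_ple ?posrE//.
apply: (@le_trans _ _ N.+1%:R); last by rewrite ler_nat.
by apply/ltW; rewrite truncnS_gt.
Qed.

End MeanToApproximate.

(** * The inner product of l2 *)

Section PartialSums.
Local Open Scope complex_scope.
Local Open Scope ring_scope.
Context {R : realType} {I : choiceType}.

Lemma cvg_partial_sum_nneg (a : I -> R) (s : R) : (forall i, 0 <= a i) ->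
  \esum_(i in setT) (a i)%:E = s%:E ->
  summability.partial_sum a A @[A --> summability.totally] --> s.
Proof.
move=> a0 sE.
have psE (A : {fset I}) :
    ((summability.partial_sum a A)%:E = \sum_(i \in [set` A]) (a i)%:E)%E.
  rewrite /summability.partial_sum -(big_seq_fsetE _ _ predT a) -sumEFin.
  by rewrite fsbig_seq//; exact: fset_uniq.
have tF := @summability.totally_filter I.
apply/cvgrPdist_le => e e0.
have [|_ [F [Ff _] <-]] := @ub_ereal_sup_adherent R
    [set (\sum_(i \in A) (a i)%:E)%E | A in fsets setT] e e0.
  by move: sE; rewrite /esum => ->.
move: (sE); rewrite {1}/esum => -> Fs.
exists (fset_set F) => // B /= FB; rewrite ger0_norm.
  rewrite lerBlDr addrC -lerBlDr -lee_fin EFinB psE.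
  apply/ltW/(lt_le_trans Fs); apply: lee_fsum_nneg_subset => //.
  - move=> i /mem_set; rewrite !inE => iF; move/fsubsetP: FB; apply.
    by rewrite in_fset_set// inE.
  - by move=> i _; rewrite lee_fin.
rewrite subr_ge0 -lee_fin psE -[leRHS]sE; apply: esum_ge.
by exists [set` B].
Qed.

Lemma cvg_real_complex T (F : set_system T) (FF : Filter F) (f : T -> R) (l : R) :
  f x @[x --> F] --> l -> ((f x)%:C : R[i]^o) @[x --> F] --> (l%:C : R[i]^o).
Proof.
move=> /cvgrPdist_le fl; apply/cvgrPdist_le => e e0.
have eR : e = (complex.Re e)%:C by rewrite RRe_real// gtr0_real.
have e0' : 0 < complex.Re e by rewrite -ltcR -eR.
apply: filterS (fl _ e0') => x.
rewrite -rmorphB eR /= normc_def /= expr0n addr0 sqrtr_sqr.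
by rewrite lecR.
Qed.

Lemma cvg_partial_sum_sqr (x : ell2 R I) :
  summability.partial_sum (fun i => `|x i| ^+ 2 : R[i]^o) A
    @[A --> summability.totally] --> ((l2norm x ^+ 2)%:C : R[i]^o).
Proof.
have /cvg_partial_sum_nneg : \esum_(i in setT) (complex.Re `|x i| ^+ 2)%:E =
    (l2norm x ^+ 2)%:E by rewrite l2normE.
move=> /(_ (fun i => sqr_ge0 _))/cvg_real_complex.
rewrite (_ : (fun A => _) = summability.partial_sum (fun i => `|x i| ^+ 2 : R[i]^o)).
  by apply; exact: summability.totally_filter.
apply/funext => A; rewrite /summability.partial_sum rmorph_sum; apply: eq_bigr => i _.
by rewrite rmorphXn /= modulusE.
Qed.

Lemma polarization (z w : R[i]) : z * w^* =
  4^-1 * (`|z + w| ^+ 2 - `|z - w| ^+ 2 +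
    'i * `|z + 'i * w| ^+ 2 - 'i * `|z - 'i * w| ^+ 2).
Proof.
rewrite !normCK !(rmorphB, rmorphD, rmorphM) /= conjCi.
have i2 : 'i * 'i = -1 :> R[i] by rewrite -expr2 sqrCi.
set a := z^*; set b := w^*.
rewrite (_ : (_ + _ - _) = 4 * (z * b) + (1 + 'i * 'i) * (2 * (w * a) - 2 * (z * b))).
  by rewrite i2 subrr mul0r addr0 mulKf// pnatr_eq0.
by ring.
Qed.

(** The inner product in terms of the norm alone.  This form needs no sum, and
    any linear isometry visibly preserves it. *)
Definition l2polar (x y : ell2 R I) : R[i] :=
  4^-1 * ((l2norm (x + y) ^+ 2)%:C - (l2norm (x - y) ^+ 2)%:C +
    'i * (l2norm (x + 'i *: y) ^+ 2)%:C - 'i * (l2norm (x - 'i *: y) ^+ 2)%:C).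

Lemma cvg_l2polar (x y : ell2 R I) :
  summability.partial_sum (fun i => x i * (y i)^* : R[i]^o) A
    @[A --> summability.totally] --> (l2polar x y : R[i]^o).
Proof.
have tF := @summability.totally_filter I.
pose s u A : R[i]^o := summability.partial_sum (fun i => `|(u : ell2 R I) i| ^+ 2 : R[i]^o) A.
rewrite (_ : summability.partial_sum _ = fun A => 4^-1 *: (s (x + y) A - s (x - y) A +
    'i *: s (x + 'i *: y) A - 'i *: s (x - 'i *: y) A)).
  have sE u : s u A @[A --> summability.totally] --> ((l2norm u ^+ 2)%:C : R[i]^o).
    exact: cvg_partial_sum_sqr.
  apply: cvgZl_tmp; apply: cvgB; last by apply: cvgZl_tmp; exact: sE.
  apply: cvgD; last by apply: cvgZl_tmp; exact: sE.
  by apply: cvgB; exact: sE.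
apply/funext => A; rewrite /s /summability.partial_sum.
rewrite !scaler_sumr -sumrB -big_split -sumrB/= scaler_sumr; apply: eq_bigr => i _.
exact: polarization.
Qed.

Lemma l2dot_lim (x y : ell2 R I) (l : R[i]) :
  summability.partial_sum (fun i => x i * (y i)^* : R[i]^o) A
    @[A --> summability.totally] --> (l : R[i]^o) -> l2dot x y = l.
Proof.
have tF := @summability.totally_filter I.
rewrite /l2dot /summability.sum => h.
exact: (@norm_cvg_lim _ (R[i]^o)).
Qed.

Lemma l2dotE (x y : ell2 R I) : l2dot x y = l2polar x y.
Proof. by apply: l2dot_lim; exact: cvg_l2polar. Qed.

Lemma l2dot_cvg (x y : ell2 R I) :
  summability.partial_sum (fun i => x i * (y i)^* : R[i]^o) A
    @[A --> summability.totally] --> (l2dot x y : R[i]^o).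
Proof. by rewrite l2dotE; exact: cvg_l2polar. Qed.

Lemma l2dotDZl (c : R[i]) (x x' y : ell2 R I) :
  l2dot (c *: x + x') y = c * l2dot x y + l2dot x' y.
Proof.
have tF := @summability.totally_filter I.
apply: l2dot_lim.
rewrite (_ : summability.partial_sum _ = fun A =>
  c *: (summability.partial_sum (fun i => x i * (y i)^* : R[i]^o) A : R[i]^o) +
  summability.partial_sum (fun i => x' i * (y i)^* : R[i]^o) A).
  by apply: cvgD; [apply: cvgZl_tmp|]; exact: l2dot_cvg.
apply/funext => A; rewrite /summability.partial_sum scaler_sumr -big_split/=.
by apply: eq_bigr => i _; rewrite mulrDl -mulrA.
Qed.

Lemma l2dotxx (x : ell2 R I) : l2dot x x = (l2norm x ^+ 2)%:C.
Proof.
have tF := @summability.totally_filter I.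
apply: l2dot_lim.
rewrite (_ : (fun i => _) = (fun i => `|x i| ^+ 2 : R[i]^o)).
  exact: cvg_partial_sum_sqr.
by apply/funext => i; rewrite normCK.
Qed.

Lemma l2normN (x : ell2 R I) : l2norm (- x) = l2norm x.
Proof. by rewrite -scaleN1r l2normZ normrN1 mul1r. Qed.

(** For [l2dot_le]: the shape of a polarization with each of its four terms
    at most r in modulus. *)
Lemma normC_le4 (a b c d : R[i]) (r : R) :
  `|a| <= r%:C -> `|b| <= r%:C -> `|c| <= r%:C -> `|d| <= r%:C ->
  `|4^-1 * (a - b + 'i * c - 'i * d)| <= r%:C.
Proof.
move=> ar br cr dr; rewrite normrM normfV normr_nat ler_pdivrMl//.
have i1 z : `|'i * z| = `|z| :> R[i] by rewrite normrM normCi mul1r.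
apply: le_trans (ler_normB _ _) _; rewrite i1.
apply: le_trans (lerD (ler_normD _ _) (lexx _)) _; rewrite i1.
apply: le_trans (lerD (lerD (ler_normB _ _) (lexx _)) (lexx _)) _.
rewrite (_ : 4 * r%:C = r%:C + r%:C + r%:C + r%:C); last by ring.
by rewrite !lerD.
Qed.

(** A crude substitute for Cauchy-Schwarz, sufficient for boundedness. *)
Lemma l2dot_le (x y : ell2 R I) :
  `|l2dot x y| <= (2 * l2norm x ^+ 2 + 2 * l2norm y ^+ 2)%:C.
Proof.
have h u : l2norm u = l2norm y ->
    `|(l2norm (x + u) ^+ 2)%:C : R[i]| <= (2 * l2norm x ^+ 2 + 2 * l2norm y ^+ 2)%:C.
  move=> <-; rewrite ger0_norm ?ler0c ?sqr_ge0// lecR; exact: l2normD2.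
have iy : l2norm ('i *: y) = l2norm y.
  by rewrite l2normZ normCi mul1r.
by rewrite l2dotE; apply: normC_le4; apply: h; rewrite ?l2normN.
Qed.

End PartialSums.

(** * States and the operators on l2 *)

Section Operators.
Local Open Scope complex_scope.
Local Open Scope ring_scope.
Context {R : realType} {I : choiceType}.
Implicit Types (S T U : bop R I) (f g : linf R I).

Lemma conj_realC (r : R) : (r%:C)^* = r%:C :> R[i].
Proof. by rewrite conj_Creal// complex_real. Qed.

Lemma l2dotC (x y : ell2 R I) : l2dot y x = (l2dot x y)^*.
Proof.
rewrite !l2dotE /l2polar !(rmorphB, rmorphD, rmorphM) /= !conjCi fmorphV rmorph_nat.
have swap (u v : ell2 R I) : l2norm (u + 'i *: v) = l2norm (v - 'i *: u).
  have -> : u + 'i *: v = 'i *: (v - 'i *: u).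
    by rewrite scalerBr scalerA -expr2 sqrCi scaleN1r opprK addrC.
  by rewrite l2normZ normCi mul1r.
rewrite !conj_realC (swap y x) -(opprB x y) (l2normN (x - y)) (addrC y x).
have -> : l2norm (y - 'i *: x) = l2norm (x + 'i *: y) by rewrite swap.
by congr (_ * _); rewrite !mulNr; ring.
Qed.

Lemma l2dotDZr (c : R[i]) (x y y' : ell2 R I) :
  l2dot x (c *: y + y') = c^* * l2dot x y + l2dot x y'.
Proof. by rewrite l2dotC l2dotDZl rmorphD rmorphM /= -!l2dotC. Qed.

Lemma bop_adjointDZ (c : R[i]) S S' T T' :
  bop_adjoint S S' -> bop_adjoint T T' ->
  bop_adjoint (c *: S + T) (c^* *: S' + T').
Proof.
move=> SS TT x y.
rewrite [LHS](l2dotDZl c (S x) (T x)) [RHS](l2dotDZr (c^*) x (S' y) (T' y)).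
by rewrite conjCK SS TT.
Qed.

Lemma bop_adjointB S S' T T' :
  bop_adjoint S S' -> bop_adjoint T T' -> bop_adjoint (S - T) (S' - T').
Proof.
move=> SS TT; have := bop_adjointDZ (-1) _ _ _ _ TT SS.
by rewrite rmorphN1 !scaleN1r addrC [- _ + _]addrC.
Qed.

Lemma bop_adjointC S T : bop_adjoint S T -> bop_adjoint T S.
Proof. by move=> ST x y; rewrite l2dotC -ST -l2dotC. Qed.

Lemma bop_adjoint1 : bop_adjoint (1 : bop R I) 1.
Proof. by []. Qed.

Lemma bop_adjointM S S' T T' :
  bop_adjoint S S' -> bop_adjoint T T' -> bop_adjoint (S * T) (T' * S').
Proof. by move=> SS TT x y; rewrite [LHS]SS [LHS]TT. Qed.

Lemma bop_scalerAl (c : R[i]) S T : c *: S * T = c *: (S * T).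
Proof. exact/val_inj. Qed.

Lemma bop_scalerAr (c : R[i]) S T : S * (c *: T) = c *: (S * T).
Proof.
apply/val_inj/funext => x /=; have [Sl _] := bopP S.
have S0 : S 0 = 0.
  by have := Sl (-1) 0 0; rewrite scaler0 addr0 scaleN1r addNr.
by have := Sl c (T x) 0; rewrite !addr0 S0 addr0.
Qed.

(** In R[i] the relation 0 <= w says that w is real and nonnegative, and an affine
    function that is nonnegative on the whole line is constant. *)
Lemma affine_ge0_slope_eq0 (P Z : R[i]) : (forall t : R, 0 <= P + t%:C * Z) -> Z = 0.
Proof.
case: P Z => [p p'] [z z'] h.
have {}h t : (p' + t * z' == 0) && (0 <= p + t * z).
  by have := h t; rewrite lecE /= !mul0r subr0 addr0.
have /andP[/eqP h0 _] := h 0; have /andP[/eqP h1 _] := h 1.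
have z'0 : z' = 0 by move: h0 h1; rewrite mul0r; lra.
have [z0|z0] := eqVneq z 0; first by rewrite z0 z'0.
(* At this value of t the real part of P + t Z is -1. *)
have /andP[_] := h (- (p + 1) / z).
rewrite divfK// => hz; have : (0 : R) < 0 by lra.
by rewrite ltxx.
Qed.

(** The case of equality to 0 in Cauchy-Schwarz.  Positivity of phi at
    (S + c U)^* (S + c U) is affine in the scalar c once phi(U^* U) = 0, hence
    its slopes along the real and the imaginary axis vanish. *)
Lemma state_null_orthogonal (phi : {scalar bop R I}) U U' S S' :
  (forall A B, bop_adjoint A B -> 0 <= phi (B * A)) ->
  bop_adjoint U U' -> bop_adjoint S S' -> phi (U' * U) = 0 ->
  phi (S' * U) = 0 /\ phi (U' * S) = 0.
Proof.
move=> pos UU SS U0; set a := phi (S' * U); set b := phi (U' * S).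
have h c : 0 <= phi (S' * S) + (c * a + c^* * b).
  have := pos _ _ (bop_adjointDZ c _ _ _ _ UU SS).
  rewrite mulrDl !mulrDr !bop_scalerAl !bop_scalerAr !linearD !linearZ /= U0 -/a -/b.
  by apply: etrans; congr (_ <= _); ring.
have /eqP ab : a + b = 0.
  apply: (affine_ge0_slope_eq0 (phi (S' * S))) => t.
  by have := h t%:C; rewrite conj_realC mulrDr.
have : 'i * (a - b) = 0.
  apply: (affine_ge0_slope_eq0 (phi (S' * S))) => t; have := h ('i * t%:C).
  rewrite rmorphM /= conj_realC conjCi; apply: etrans; congr (_ <= _ + _); ring.
move/eqP; rewrite mulf_eq0 (negPf (neq0Ci _)) /= subr_eq0 => /eqP eab.
move: ab; rewrite eab -mulr2n mulrn_eq0/= => /eqP ->; by [].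
Qed.

End Operators.

Section Multiplication.
Local Open Scope complex_scope.
Local Open Scope ring_scope.
Context {R : realType} {I : choiceType}.
Implicit Types (f g : linf R I).

Lemma linf_modulus_bound f : exists M : R, forall i, complex.Re `|f i| <= M.
Proof.
have [M fM] := linfP f; exists (complex.Re M) => i.
by have := fM i; rewrite lecE => /andP[].
Qed.

Lemma sqsum_mul (f : linf R I) (M : R) (x : I -> R[i]) :
  (forall i, complex.Re `|f i| <= M) ->
  (sqsum (fun i => f i * x i)%R <= (M ^+ 2)%:E * sqsum x)%E.
Proof.
move=> fM; rewrite /sqsum -esumZ ?sqr_ge0//; last by move=> i; rewrite lee_fin sqr_ge0.
apply: le_esum => i _; rewrite -EFinM lee_fin modulusM exprMn ler_wpM2r ?sqr_ge0//.
by rewrite lerXn2r ?nnegrE ?modulus_ge0// (le_trans _ (fM i)) ?modulus_ge0.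
Qed.

Lemma mul_sqsummable (f : linf R I) (x : ell2 R I) :
  (fun i => f i * x i) \in @sqsummable R I.
Proof.
have [M fM] := linf_modulus_bound f; rewrite inE.
apply: le_lt_trans (sqsum_mul _ _ _ fM) _.
by rewrite lte_mul_pinfty// ?lee_fin ?sqr_ge0//; exact: (valP x).
Qed.

Definition mul_fun (f : linf R I) (x : ell2 R I) : ell2 R I :=
  Ell2 (mul_sqsummable f x).

Lemma mul_bounded f : mul_fun f \in @bounded_linear_pred R I.
Proof.
apply/bounded_linearP; split=> [c x y|].
  apply/val_inj/funext => i /=.
  rewrite [RHS](_ : _ = c * (f i * x i) + f i * y i)// [LHS](_ : _ = f i * (c * x i + y i))//.
  by rewrite mulrDr mulrCA.
have [M fM] := linf_modulus_bound f.
apply: (@bounded_sq _ _ _ (M ^+ 2)) => x.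
by rewrite -lee_fin [leRHS]EFinM !l2normE sqsum_mul.
Qed.

Definition mul_op f : bop R I := Bop (mul_bounded f).

Lemma mul_op_linear : linear mul_op.
Proof.
move=> c f g; apply/val_inj/funext => x; apply/val_inj/funext => i.
rewrite [RHS](_ : _ = c * (f i * x i) + g i * x i)//.
by rewrite [LHS](_ : _ = (c * f i + g i) * x i)// mulrDl mulrA.
Qed.

Lemma mul_opM f g : mul_op (f * g) = mul_op f * mul_op g.
Proof.
apply/val_inj/funext => x; apply/val_inj/funext => i /=.
by rewrite -mulrA.
Qed.

Lemma mul_op_adjoint f g : linf_adjoint f g -> bop_adjoint (mul_op f) (mul_op g).
Proof.
move=> fg x y; rewrite /l2dot; congr (@summability.sum I R[i] R[i]^o _); apply/funext => i /=.
by rewrite fg rmorphM /= conjCK -mulrA mulrCA.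
Qed.

Lemma linf_conj_bounded f : (fun i => (f i)^*) \in @bounded_pred R I.
Proof.
by apply/bounded_predP; have [M fM] := linfP f; exists M => i; rewrite norm_conjC.
Qed.
Definition linf_star f : linf R I := Linf (linf_conj_bounded f).
Lemma linf_starP f : linf_adjoint f (linf_star f).
Proof. by []. Qed.

End Multiplication.

Section Conjugation.
Context {R : realType} {G : groupType}.
Implicit Types (g h : G).

Lemma conj_repM g h : conj_rep R g * conj_rep R h = conj_rep R (g * h)%g.
Proof.
apply/val_inj/funext => x; apply/val_inj/funext => k /=.
by rewrite invgM !mulgA.
Qed.

Lemma conj_rep1 : conj_rep R (1%g : G) = 1.
Proof.
apply/val_inj/funext => x; apply/val_inj/funext => k /=.
by rewrite invg1 mul1g mulg1.
Qed.

Lemma l2norm_conj g (x : ell2 R G) : l2norm (conj_rep R g x) = l2norm x.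
Proof. by rewrite /l2norm sqsum_conj. Qed.

(** Conjugation is unitary: it preserves the norms in [l2polar]. *)
Lemma conj_rep_adjoint g : bop_adjoint (conj_rep R g) (conj_rep R g^-1%g).
Proof.
move=> x y.
have -> : y = conj_rep R g (conj_rep R g^-1%g y).
  rewrite -[RHS]/((conj_rep R g * conj_rep R g^-1%g) y) conj_repM mulgV.
  by rewrite conj_rep1.
set z := conj_rep R g^-1%g y.
have -> : conj_rep R g^-1%g (conj_rep R g z) = z.
  by rewrite -[LHS]/((conj_rep R g^-1%g * conj_rep R g) z) conj_repM mulVg conj_rep1.
have gD u v : conj_rep R g u + conj_rep R g v = conj_rep R g (u + v) by exact/val_inj.
have gN u : - conj_rep R g u = conj_rep R g (- u) by exact/val_inj.
have gZ c u : c *: conj_rep R g u = conj_rep R g (c *: u) by exact/val_inj.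
by rewrite !l2dotE /l2polar !gZ !gN !gD !l2norm_conj.
Qed.

End Conjugation.

Section Extension.
Context {R : realType} {G : groupType}.
Variable H : groupClosed G.
Local Notation X := (compl_type H).
Implicit Types (f g : linf R X).

Definition linf_ext_fun f (k : G) : R[i] := if insub k is Some x then f x else 0.

Lemma linf_ext_bounded f : linf_ext_fun f \in @bounded_pred R G.
Proof.
apply/bounded_predP; have [M fM] := linfP f; exists `|M| => k.
rewrite /linf_ext_fun; case: insubP => [x _ _|_]; last by rewrite normr0.
by apply: le_trans (fM x) _; rewrite real_ler_norm// ger0_real// (le_trans _ (fM x)).
Qed.

Definition linf_ext f : linf R G := Linf (linf_ext_bounded f).

Lemma linf_ext_val f (x : X) : linf_ext f (val x) = f x.
Proof. by rewrite /= /linf_ext_fun valK. Qed.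

Lemma linf_ext_out f k : k \in H -> linf_ext f k = 0.
Proof. by move=> kH; rewrite /= /linf_ext_fun insubF// kH. Qed.

Lemma linf_ext_linear : linear linf_ext.
Proof.
move=> c f g; apply/val_inj/funext => k /=.
rewrite [RHS](_ : _ = c * linf_ext_fun f k + linf_ext_fun g k)// /linf_ext_fun.
by case: insub => //; rewrite mulr0 addr0.
Qed.

Lemma linf_extM f g : linf_ext (f * g) = linf_ext f * linf_ext g.
Proof.
apply/val_inj/funext => k /=; rewrite /linf_ext_fun.
by case: insub => //; rewrite mulr0.
Qed.

Lemma linf_ext_adjoint f g : linf_adjoint f g -> linf_adjoint (linf_ext f) (linf_ext g).
Proof.
move=> fg k /=; rewrite /linf_ext_fun; case: insub => [x|]; first exact: fg.
by rewrite conjC0.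
Qed.

Lemma mul_op_ext1 : mul_op (linf_ext 1) = 1 - restr_proj R H.
Proof.
apply/val_inj/funext => x; apply/val_inj/funext => k.
rewrite [RHS](_ : _ = x k - (if k \in H then x k else 0))//.
rewrite [LHS](_ : _ = linf_ext 1 k * x k)//.
case: ifPn => kH; first by rewrite linf_ext_out// mul0r subrr.
by rewrite -[k]/(val (Sub k kH : X)) linf_ext_val mul1r subr0.
Qed.

Lemma mul_op_conj h (hH : h \in H) f : mul_op (linf_ext (linf_conj hH f)) =
  conj_rep R h * (mul_op (linf_ext f) * conj_rep R h^-1%g).
Proof.
apply/val_inj/funext => x; apply/val_inj/funext => k.
rewrite [LHS](_ : _ = linf_ext (linf_conj hH f) k * x k)//.
rewrite [RHS](_ : _ = linf_ext f (h^-1 * k * h)%g * x (h^-1^-1 * (h^-1 * k * h) * h^-1)%g)//.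
rewrite invgK !mulgA mulgV mul1g mulgK; congr (_ * _).
have [kH|kH] := boolP (k \in H).
  by rewrite !linf_ext_out// gpredMr// gpredMl ?gpredV.
pose y : X := Sub k kH.
rewrite -[LHS]/(linf_ext (linf_conj hH f) (val y)).
by rewrite -[RHS]/(linf_ext f (val (compl_conjV hH y))) !linf_ext_val.
Qed.

(** The mean is f |-> phi(M_f), where M_f is multiplication by the extension of f
    by 0.  With a = alpha(h) and a' its adjoint, invariance reads
    phi(a M_f a') = phi(M_f), and both outer factors can be removed because
    phi((a - 1) (a' - 1)) = 0. *)
Lemma state_to_mean (phi : {scalar bop R G}) : (exists k : G, k \notin H) ->
  bop_state phi -> (forall h, h \in H -> phi (conj_rep R h) = 1) ->
  phi (restr_proj R H) = 0 -> inner_amenable_rel R H.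
Proof.
move=> Hp [phi1 pos] phiH phie; split=> //.
pose psi f := phi (mul_op (linf_ext f)).
have psil : linear_for *%R psi.
  by move=> c f g; rewrite /psi linf_ext_linear mul_op_linear linearP.
pose psim := GRing.isLinear.Build R[i] (linf R X) R[i] *%R psi psil.
pose psiL : {scalar linf R X} := HB.pack psi psim.
exists psiL; split.
  split=> [|a b ab]; first by rewrite /= /psi mul_op_ext1 linearB /= phie subr0.
  rewrite /= /psi linf_extM mul_opM; apply: pos.
  exact/mul_op_adjoint/linf_ext_adjoint.
move=> h hH f; rewrite /= /psi mul_op_conj.
set M := mul_op (linf_ext f); set a := conj_rep R h; set a' := conj_rep R h^-1%g.
have ha : bop_adjoint a a' by exact: conj_rep_adjoint.
have h1 : bop_adjoint (a - 1) (a' - 1) by exact: bop_adjointB _ _ _ _ ha bop_adjoint1.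
have h1' := bop_adjointC _ _ h1.
have aa : a * a' = 1 by rewrite conj_repM mulgV conj_rep1.
have phia : phi a = 1 by rewrite phiH.
have phia' : phi a' = 1 by rewrite phiH ?gpredV.
have phi1' : phi 1 = 1 by exact: phi1.
have z1 : phi ((a - 1) * (a' - 1)) = 0.
  rewrite mulrBl !mulrBr aa !mulr1 !mul1r !linearB /= phia phia' phi1'.
  by rewrite !subrr addr0.
have hM := mul_op_adjoint _ _ (linf_starP (linf_ext f)).
have hMa := bop_adjointM _ _ _ _ hM (bop_adjointC _ _ ha).
(* Drop a from the left of M a', then a' from the right. *)
have [_ e1] := state_null_orthogonal phi _ _ _ _ pos h1' hMa z1.
have [e2 _] := state_null_orthogonal phi _ _ _ _ pos h1' (bop_adjointC _ _ hM) z1.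
move: e1 e2; rewrite -/M; rewrite mulrBl mulrBr mul1r mulr1 !linearB /=.
by move=> /subr0_eq -> /subr0_eq.
Qed.

End Extension.

(** * Limits of vector states along an ultrafilter *)

Section UltraLimits.
Local Open Scope complex_scope.
Local Open Scope ring_scope.
Context {R : realType} {D : Type}.
Variables (U : set_system D) (ultraU : UltraFilter U).

(** A cluster point along an ultrafilter is a limit. *)
Lemma ultra_cvg_segment (f : D -> R) (a b : R) : (forall n, a <= f n <= b) ->
  exists2 l, a <= l <= b & f n @[n --> U] --> l.
Proof.
move=> fab.
have [|l [lab lcl]] := @segment_compact R a b (f n @[n --> U]) _.
  by apply: (@filterE _ U) => n /=; rewrite in_itv; exact: fab.
exists l; first by move: lab; rewrite /= in_itv.
move=> V Vl; have [//|UV] := in_ultra_setVsetC (f @^-1` V) ultraU.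
by have [y [/= nVy Vy]] := lcl (~` V) V UV Vl.
Qed.

Lemma ultra_cvg_complex (f : D -> R[i]) (M : R) : (forall n, `|f n| <= M%:C) ->
  exists l : R[i], (f n : R[i]^o) @[n --> U] --> (l : R[i]^o).
Proof.
move=> fM.
have ReM n : - M <= complex.Re (f n) <= M.
  rewrite -ler_norml -lecR; apply: le_trans (fM n); exact: normc_ge_Re.
have ImM n : - M <= complex.Im (f n) <= M.
  rewrite -ler_norml -lecR; apply: le_trans (fM n).
  rewrite normc_def lecR -sqrtr_sqr ler_sqrt ?addr_ge0 ?sqr_ge0//.
  by rewrite lerDr sqr_ge0.
have [a _ fa] := ultra_cvg_segment _ _ _ ReM.
have [b _ fb] := ultra_cvg_segment _ _ _ ImM.
exists (a%:C + 'i * b%:C).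
rewrite (_ : (fun n => f n : R[i]^o) =
    (fun n => (complex.Re (f n))%:C + 'i *: ((complex.Im (f n))%:C : R[i]^o))).
  by apply: cvgD; [|apply: cvgZl_tmp]; exact: cvg_real_complex.
by apply/funext => n; rewrite [LHS]complexE complexiE.
Qed.

End UltraLimits.

Section ApproximateToState.
Context {R : realType} {G : groupType}.
Local Open Scope complex_scope.
Local Open Scope ring_scope.

Lemma net_filter_proper (D : Type) (le : D -> D -> Prop) :
  directed le -> ProperFilter (net_filter le).
Proof.
move=> [[d] refl trans dir]; apply: filter_from_proper; last first.
  by move=> n _; exists n; exact: refl.
apply: filter_from_filter; first by exists d.
move=> m n _ _; have [p [mp np]] := dir m n.
by exists p => // q /= pq; split; exact: trans pq.
Qed.

Lemma l2dot0l (y : ell2 R G) : l2dot 0 y = 0.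
Proof.
have := l2dotDZl 1 0 0 y; rewrite scaler0 addr0 mul1r => /eqP.
by rewrite -subr_eq0 opprD addNKr oppr_eq0 => /eqP.
Qed.

(** phi(T) is the limit of v T n = <T xi_n, xi_n>, which stays bounded in n since
    the xi_n are unit vectors. *)
Lemma approximate_to_state (H : groupClosed G) (D : Type) (le : D -> D -> Prop)
    (xi : D -> ell2 R G) :
  directed le -> (forall n, l2norm (xi n) = 1) ->
  (forall n, supp (xi n) `<=` [set g | g \notin H]) ->
  (forall h, h \in H ->
     l2norm (conj_rep R h (xi n) - xi n) @[n --> net_filter le] --> (0 : R)) ->
  exists phi : {scalar bop R G},
     [/\ bop_state phi,
         forall h, h \in H -> phi (conj_rep R h) = 1 &
         phi (restr_proj R H) = 0].
Proof.
move=> /net_filter_proper Fle xi1 xiH xiinv.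
have [U [ultraU leU]] := ultraFilterLemma Fle.
pose v (T : bop R G) n : R[i]^o := l2dot (T (xi n)) (xi n).
have T_le (T : bop R G) : exists M : R, forall n, l2norm (T (xi n)) ^+ 2 <= M.
  have [_ [M TM]] := bopP T; exists (M ^+ 2) => n; have := TM (xi n).
  by rewrite xi1 mulr1 => h; rewrite lerXn2r ?nnegrE// ?(le_trans _ h) ?l2norm_ge0.
have cvgv T : exists l : R[i], v T n @[n --> U] --> (l : R[i]^o).
  have [M TM] := T_le T.
  apply: (ultra_cvg_complex U ultraU _ (2 * M + 2)) => n.
  apply: le_trans (l2dot_le _ _) _; rewrite lecR xi1 expr1n mulr1 lerD2r.
  by rewrite ler_wpM2l.
have [phi phiE] := choice cvgv.
have phi_uniq T (l : R[i]) : v T n @[n --> U] --> (l : R[i]^o) -> phi T = l.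
  move=> vl; have := phiE T; move/(@norm_cvg_lim _ (R[i]^o)) => <-.
  exact: (@norm_cvg_lim _ (R[i]^o)).
have phil : linear_for *%R phi.
  move=> c S T; apply: phi_uniq.
  rewrite (_ : v _ = fun n => c *: v S n + v T n).
    by apply: cvgD; [apply: cvgZl_tmp|]; exact: phiE.
  by apply/funext => n; exact: (l2dotDZl c (S (xi n)) (T (xi n))).
have vpos S T : bop_adjoint S T -> forall n, v (T * S) n = (l2norm (S (xi n)) ^+ 2)%:C.
  by move=> ST n; rewrite /v l2dotC -[l2dot _ _]ST l2dotxx conj_realC.
pose phim := GRing.isLinear.Build R[i] (bop R G) R[i] *%R phi phil.
pose phiL : {scalar bop R G} := HB.pack phi phim.
have pos S T : bop_adjoint S T -> 0 <= phiL (T * S).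
  move=> ST /=; have [M SM] := T_le S.
  have [|l /andP[l0 _] vl] := @ultra_cvg_segment R D U ultraU
      (fun n => l2norm (S (xi n)) ^+ 2) 0 M.
    by move=> n; rewrite sqr_ge0 SM.
  rewrite (phi_uniq _ l%:C) ?ler0c//.
  by under eq_fun do rewrite (vpos _ _ ST); exact: cvg_real_complex.
have phi1 : phiL 1 = 1.
  apply: phi_uniq; rewrite (_ : v 1 = fun=> 1); first exact: cvg_cst.
  by apply/funext => n; rewrite /v l2dotxx xi1 expr1n.
exists phiL; split; first by split.
- move=> h hH.
  have ha : bop_adjoint (conj_rep R h - 1) (conj_rep R h^-1%g - 1).
    exact: bop_adjointB _ _ _ _ (conj_rep_adjoint h) bop_adjoint1.
  have phi0 : phiL ((conj_rep R h^-1%g - 1) * (conj_rep R h - 1)) = 0.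
    apply: phi_uniq; under eq_fun do rewrite (vpos _ _ ha).
    apply: cvg_real_complex; rewrite -(mul0r (0 : R)).
    by apply: cvgM => V /(xiinv h hH); exact: leU.
  have [+ _] := state_null_orthogonal phiL _ _ _ _ pos ha bop_adjoint1 phi0.
  by rewrite mul1r linearB /= [phi 1]phi1 => /subr0_eq.
- apply: phi_uniq; rewrite (_ : v _ = fun=> 0); first exact: cvg_cst.
  apply/funext => n; rewrite /v (_ : restr_proj _ _ _ = 0) ?l2dot0l//.
  apply/val_inj/funext => k /=; case: ifPn => // kH.
  by have [//|kxi] := eqVneq (xi n k) 0; have := xiH n k kxi; rewrite /= kH.
Qed.

End ApproximateToState.

(** * The equivalence *)

Theorem theoremA (R : realType) (G : groupType) (H : groupClosed G)
    (H_proper : exists g : G, g \notin H) :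
  (inner_amenable_rel R H <->
   exists (D : Type) (le : D -> D -> Prop) (xi : D -> ell2 R G),
     [/\ directed le,
         forall n, l2norm (xi n) = 1,
         forall n, supp (xi n) `<=` [set g | g \notin H] &
         forall h, h \in H ->
           l2norm (conj_rep R h (xi n) - xi n) @[n --> net_filter le] -->
             (0 : R)])
  /\
  (inner_amenable_rel R H <->
   exists phi : {scalar bop R G},
     [/\ bop_state phi,
         forall h, h \in H -> phi (conj_rep R h) = 1 &
         phi (restr_proj R H) = 0]).

Proof.
have approx_to_state := @approximate_to_state R G H.
have state_to_mean := @state_to_mean R G H.
split; split.
- exact: mean_to_approximate.
- move=> [D [le [xi [dirle xi1 xiH xiinv]]]].
  have [phi [phiS phiH phie]] := approx_to_state _ _ _ dirle xi1 xiH xiinv.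
  exact: state_to_mean phi H_proper phiS phiH phie.
- move=> /mean_to_approximate[D [le [xi [dirle xi1 xiH xiinv]]]].
  exact: approx_to_state dirle xi1 xiH xiinv.
- by move=> [phi [phiS phiH phie]]; exact: state_to_mean phi H_proper phiS phiH phie.
Qed.
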